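(* Let $\mathbf{L}\in\mathbb{R}^{n\times n}$ be the symmetric normalized Laplacian of an undirected graph on $n$ nodes, let $K\ge 0$, and let $\mathbf{W}_0,\ldots,\mathbf{W}_K\in\mathbb{R}^{d\times d}$ satisfy $-\mathbf{W}_k=\mathbf{W}_k^\top$ for all $k=0,\ldots,K$. Consider the ordinary differential equation $$\frac{d\mathbf{X}(t)}{dt}=\sum_{k=0}^{K}T_k(\mathbf{L})\,\mathbf{X}(t)\,\mathbf{W}_k,\qquad t\in[0,T],\quad \mathbf{X}(0)=\mathbf{X}^{(0)}\in\mathbb{R}^{n\times d}.$$ Then the graph-wise Jacobian $\mathbf{J}$ of this ODE has purely imaginary eigenvalues, i.e. every eigenvalue $\lambda_i(\mathbf{J})$ of $\mathbf{J}$ satisfies $$\operatorname{Re}(\lambda_i(\mathbf{J}))=0\quad\text{for all } i.$$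
   Context: The symmetric normalized Laplacian of an undirected graph with adjacency matrix $\mathbf{A}$ and degree matrix $\mathbf{D}$ is $\mathbf{L}=\mathbf{I}-\mathbf{D}^{-1/2}\mathbf{A}\mathbf{D}^{-1/2}$; it is a real symmetric matrix. $T_k$ is the $k$-th Chebyshev polynomial of the first kind ($T_0(x)=1$, $T_1(x)=x$, $T_k(x)=2xT_{k-1}(x)-T_{k-2}(x)$), applied to $\mathbf{L}$ as a matrix polynomial. The graph-wise Jacobian of the ODE is the $nd\times nd$ Jacobian of its vectorized right-hand side: $\mathbf{J}=\partial\operatorname{vec}(F(\mathbf{X}))/\partial\operatorname{vec}(\mathbf{X})$ with $F(\mathbf{X})=\sum_{k=0}^{K}T_k(\mathbf{L})\mathbf{X}\mathbf{W}_k$, where $\operatorname{vec}$ stacks the columns of a matrix. ''Purely imaginary'' includes the value $0$. *)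

(* Defs.v *)
From mathcomp Require Import all_boot all_order all_algebra.
From mathcomp Require Import all_classical all_reals all_analysis.
From mathcomp Require Import complex.

Set Implicit Arguments.
Unset Strict Implicit.
Unset Printing Implicit Defensive.

Import Order.TTheory GRing.Theory Num.Theory.
Import numFieldNormedType.Exports.

Local Open Scope ring_scope.

Section NormalizedLaplacian.
Context {R : realType} {n : nat}.
Implicit Types e : rel 'I_n.

Definition adjacency e : 'M[R]_n := \matrix_(i, j) (e i j)%:R.

Definition degree e (i : 'I_n) : R := \sum_j adjacency e i j.

(* D^{-1/2}. Since 0^-1 = 0, an isolated vertex gets the diagonal entry 0,
   which is the usual convention. *)
Definition inv_sqrt_degree e : 'M[R]_n :=
  diag_mx (\row_i (Num.sqrt (degree e i))^-1).

Definition normalized_laplacian e : 'M[R]_n :=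
  1%:M - inv_sqrt_degree e *m adjacency e *m inv_sqrt_degree e.

End NormalizedLaplacian.

Fixpoint chebyshev (R : nzRingType) (k : nat) : {poly R} :=
  match k with
  | 0 => 1
  | 1 => 'X
  | (m.+1 as p).+1 => 2%:R *: 'X * chebyshev R p - chebyshev R m
  end.

Section GraphJacobian.
Context {R : realType} {n d : nat}.

(* mxvec is row-major, so the transposition makes vec stack columns. *)
Definition vec (X : 'M[R]_(n, d)) : 'rV[R]_(d * n) := mxvec X^T.

Definition unvec (v : 'rV[R]_(d * n)) : 'M[R]_(n, d) := (vec_mx v)^T.

(* The library's Jacobian acts on row vectors, so its (i, j) entry is the
   derivative of component j in direction i; transposing gives the usual
   d vec(F(X))_i / d vec(X)_j. *)
Definition graph_jacobian (F : 'M[R]_(n, d) -> 'M[R]_(n, d)) (X : 'M[R]_(n, d))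
    : 'M[R]_(d * n) :=
  (jacobian (fun v => vec (F (unvec v))) (vec X))^T.

End GraphJacobian.

(* The right-hand side F of dX/dt = F(X). *)
Definition cheb_field {R : realType} {n d K : nat} (L : 'M[R]_n.+1)
    (W : 'I_K.+1 -> 'M[R]_d) (X : 'M[R]_(n.+1, d)) : 'M[R]_(n.+1, d) :=
  \sum_(k < K.+1) horner_mx L (chebyshev R k) *m X *m W k.

(* Main.v *)
(* The Jacobian of the linear field F is the matrix of F itself. For the
   Frobenius inner product <X, Y> = tr (X^T Y), each term S X W with S symmetric
   and W skew-symmetric satisfies <S X W, Y> = - <X, S Y W>. Hence J is a real
   skew-symmetric matrix, and v J v^* computed in two ways gives
   lambda |v|^2 = - lambda^* |v|^2 for every eigenvector v. *)
Require Import Defs.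
From HB Require Import structures.
From mathcomp Require Import all_boot all_order all_algebra.
From mathcomp Require Import all_classical all_reals all_analysis.
From mathcomp Require Import complex.

Import Order.TTheory GRing.Theory Num.Theory.
Import numFieldNormedType.Exports.

Local Open Scope ring_scope.

(** In finite dimension [f v] is a finite sum of coordinates of [v] times fixed vectors, and each
    such term is continuous. Continuity is what makes a linear map its own differential. *)
Lemma continuous_linear_rV {R : realType} {m k : nat}
  (f : {linear 'rV[R]_m -> 'rV[R]_k}) : continuous f.
Proof.
have -> : (f : 'rV[R]_m -> 'rV[R]_k) =
    fun v => \sum_i v 0 i *: f (delta_mx 0 i).
  apply/funext => v; rewrite {1}(row_sum_delta v) linear_sum.
  by apply: eq_bigr => i _; rewrite linearZ.
apply: continuous_big => [|i _ v]; first exact: add_continuous.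
exact: (continuous_comp (@coord_continuous R 1 m 0 i v)
  (@scalel_continuous R _ (f (delta_mx 0 i)) (v 0 i))).
Qed.

Lemma jacobian_linear {R : realType} {m k : nat}
  (f : {linear 'rV[R]_m -> 'rV[R]_k}) (p : 'rV[R]_m) :
  jacobian f p = lin1_mx f.
Proof. by rewrite /jacobian diff_lin //; exact: continuous_linear_rV. Qed.

Lemma trmx_horner_mx {R : comNzRingType} {n : nat} (A : 'M[R]_n.+1)
  (p : {poly R}) : (horner_mx A p)^T = horner_mx A^T p.
Proof.
elim/poly_ind: p => [|p c IHp]; first by rewrite !rmorph0 trmx0.
rewrite !rmorphD !rmorphM /= !horner_mx_X !horner_mx_C linearD /= tr_scalar_mx.
congr (_ + _); rewrite trmx_mul IHp.
(* Transposition has reversed the product, which is harmless because a matrix commutes with its own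
   polynomials. *)
by apply: (comm_mx_horner p); apply: comm_mx_refl.
Qed.

Lemma trmx_normalized_laplacian {R : realType} {n : nat} (e : rel 'I_n) :
  symmetric e ->
  (normalized_laplacian (R := R) e)^T = normalized_laplacian e.
Proof.
move=> e_sym; rewrite /normalized_laplacian linearB /= trmx1 !trmx_mul.
rewrite /inv_sqrt_degree tr_diag_mx mulmxA.
suff -> : (adjacency e)^T = adjacency (R := R) e by [].
by apply/matrixP => i j; rewrite !mxE e_sym.
Qed.

(** Carries skewness of the field for the Frobenius product over to skewness of its matrix. *)
Lemma vec_dotmul {R : realType} {n d : nat} (X Y : 'M[R]_(n, d)) :
  (vec X *m (vec Y)^T) 0 0 = \tr (X^T *m Y).
Proof.
rewrite mxE (reindex _ (curry_mxvec_bij _ _)) /= /mxtrace.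
under [RHS]eq_bigr do rewrite mxE.
rewrite pair_bigA /=; apply: eq_bigr => -[i j] _ /=.
by rewrite mxE !mxvecE !mxE.
Qed.

Lemma dotmul_delta {R : pzRingType} {m : nat} (u : 'rV[R]_m) (j : 'I_m) :
  (u *m (delta_mx (0 : 'I_1) j)^T) 0 0 = u 0 j.
Proof. by rewrite trmx_delta -colE mxE. Qed.

Lemma unvecK {R : realType} {n d : nat} : cancel (@unvec R n d) vec.
Proof. by move=> v; rewrite /vec /unvec trmxK vec_mxK. Qed.

Lemma cheb_field_skew {R : realType} {n d K : nat} (L : 'M[R]_n.+1)
  (W : 'I_K.+1 -> 'M[R]_d) (X Y : 'M[R]_(n.+1, d)) :
  L^T = L -> (forall k, - W k = (W k)^T) ->
  \tr ((cheb_field L W X)^T *m Y) = - \tr (X^T *m cheb_field L W Y).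
Proof.
move=> L_sym W_skew; rewrite /cheb_field linear_sum mulmx_suml mulmx_sumr.
rewrite !(linear_sum mxtrace) -sumrN; apply: eq_bigr => k _ /=.
rewrite !trmx_mul trmx_horner_mx L_sym -W_skew !mulNmx linearN /=.
(* Cyclicity of the trace moves [W k] from the front to the back. *)
by rewrite -!mulmxA mxtrace_mulC !mulmxA.
Qed.

Lemma vec_cheb_field_linear {R : realType} {n d K : nat} (L : 'M[R]_n.+1)
  (W : 'I_K.+1 -> 'M[R]_d) : linear (fun v => vec (cheb_field L W (unvec v))).
Proof.
move=> a u v; rewrite /vec -!linearP; congr (mxvec _^T).
rewrite /cheb_field scaler_sumr -big_split; apply: eq_bigr => k _ /=.
by rewrite /unvec !linearP /= mulmxDl -scalemxAl.
Qed.

Lemma graph_jacobian_cheb_field_skew {R : realType} {n d K : nat}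
  (L : 'M[R]_n.+1) (W : 'I_K.+1 -> 'M[R]_d) (X : 'M[R]_(n.+1, d)) :
  L^T = L -> (forall k, - W k = (W k)^T) ->
  (graph_jacobian (cheb_field L W) X)^T = - graph_jacobian (cheb_field L W) X.
Proof.
move=> L_sym W_skew; rewrite /graph_jacobian trmxK.
set f := fun v => _.
pose g : {linear 'rV[R]_(d * n.+1) -> 'rV[R]_(d * n.+1)} :=
  HB.pack f (GRing.isLinear.Build _ _ _ _ f (vec_cheb_field_linear L W)).
rewrite (jacobian_linear g) /=.
apply/matrixP => i j; rewrite !mxE.
(* The goal is now f(e_i)_j = - f(e_j)_i. Both sides become dot products with basis vectors, then
   Frobenius products of matrices. *)
rewrite -[LHS]dotmul_delta -[X in _ = - X]dotmul_delta.
rewrite -[X in (_ *m X^T) _ _ = _]unvecK -[X in _ = - (_ *m X^T) _ _]unvecK.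
by rewrite !vec_dotmul cheb_field_skew // -mxtrace_tr trmx_mul trmxK.
Qed.

Lemma skew_eigenvalue_Re0 {R : rcfType} {m : nat} (J : 'M[R]_m)
  (lambda : R[i]) :
  J^T = - J -> eigenvalue (map_mx (real_complex R) J) lambda ->
  complex.Re lambda = 0.
Proof.
move=> J_skew /eigenvalueP [v vJ v_neq0].
(* The eigenvector [v] is a row, so [w] is the column v^*. Conjugating and transposing v J = lambda
   v, with J real and skew, gives [Jw]. *)
pose w := (map_mx conjc v)^T.
have Jw : map_mx (real_complex R) J *m w = - conjc lambda *: w.
  rewrite -[LHS]trmxK trmx_mul trmxK map_trmx J_skew map_mxN mulmxN.
  have -> : map_mx (real_complex R) J = map_mx conjc (map_mx (real_complex R) J).
    by apply/matrixP => i j; rewrite !mxE conjc_real.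
  by rewrite -map_mxM vJ map_mxZ linearN /= linearZ /= scaleNr.
have vw_neq0 : (v *m w) 0 0 != 0.
  (* The product v w is a sum of nonnegative terms, so it vanishes only if every coordinate of [v]
     does. *)
  have nE i : v 0 i * w i 0 = `|v 0 i| ^+ 2 by rewrite !mxE sqr_normc.
  apply: contra v_neq0; rewrite mxE psumr_eq0 => [/allP v0|i _]; last first.
    by rewrite nE exprn_ge0.
  apply/eqP/rowP => i; rewrite mxE; apply/eqP.
  by have := v0 i (mem_index_enum i); rewrite /= nE expf_eq0 /= normr_eq0.
have : lambda *: (v *m w) = - conjc lambda *: (v *m w).
  by rewrite scalemxAl -vJ -mulmxA Jw scalemxAr.
move=> /(congr1 (fun A : 'M[R[i]]_1 => A 0 0)); rewrite [LHS]mxE [RHS]mxE.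
move=> /eqP; rewrite -subr_eq0 -mulrBl mulf_eq0 (negbTE vw_neq0).
(* What remains is lambda + lambda^* = 0, whose left side is twice the real part of [lambda],
   embedded in [R[i]]. *)
rewrite orbF opprK addcJ mulf_eq0 pnatr_eq0 /= => /eqP.
exact: complexI.
Qed.

Theorem theorem3 (R : realType) (n d K : nat)
  (e : rel 'I_n.+1) (e_sym : symmetric e)
  (W : 'I_K.+1 -> 'M[R]_d) (W_skew : forall k, - W k = (W k)^T)
  (X : 'M[R]_(n.+1, d)) (lambda : R[i]) :
  eigenvalue
    (map_mx (real_complex R)
       (graph_jacobian (cheb_field (normalized_laplacian e) W) X)) lambda ->
  complex.Re lambda = 0.
Proof.
apply: skew_eigenvalue_Re0; apply: graph_jacobian_cheb_field_skew => //.
exact: trmx_normalized_laplacian.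
Qed.
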